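(* Let $G$ be a finite simple graph of order $n$. If $Z(D_t(G,x))=\{-2,0\}$, then $\kappa(G)\le 2$.
   Context: For a finite simple graph $G=(V,E)$, a set $D\subseteq V$ is a total dominating set if every vertex of $V$ is adjacent to some vertex of $D$. $d_t(G,i)$ is the number of total dominating sets of $G$ of cardinality $i$, and $D_t(G,x)=\sum_i d_t(G,i)x^i$ is the total domination polynomial. $Z(D_t(G,x))$ denotes the set of distinct (complex) roots of $D_t(G,x)$. The (vertex) connectivity $\kappa(G)$ of a connected non-complete graph $G$ is the smallest integer $k$ such that there is a set $V'\subseteq V$ of $k$ vertices with $G-V'$ not connected; by the usual conventions $\kappa(G)=0$ if $G$ is disconnected and $\kappa(K_n)=n-1$. *)

(* Defs.v *)
From mathcomp Require Import all_boot all_order all_algebra.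
From mathcomp Require Import complex.
From mathcomp Require Import reals.

Set Implicit Arguments.
Unset Strict Implicit.
Unset Printing Implicit Defensive.

Import Order.TTheory GRing.Theory Num.Theory.
Local Open Scope ring_scope.

(* A finite simple graph is a symmetric irreflexive relation [e] on a [finType]
   of vertices. *)

Definition total_dominating (V : finType) (e : rel V) (D : {set V}) : bool :=
  [forall v, exists u in D, e v u].

Definition total_dom_count (V : finType) (e : rel V) (i : nat) : nat :=
  #|[set D : {set V} | total_dominating e D & #|D| == i]|.

Definition total_dom_poly (V : finType) (e : rel V) : {poly int} :=
  \poly_(i < #|V|.+1) (total_dom_count e i)%:Z.

Definition complex_roots (R : realType) (p : {poly int}) : pred R[i] :=
  fun z => root (map_poly intr p) z.
Arguments complex_roots R p : clear implicits.

Definition graph_connected (V : finType) (e : rel V) : bool :=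
  [forall x, forall y, connect e x y].

Definition graph_complete (V : finType) (e : rel V) : bool :=
  [forall x, forall y, (x != y) ==> e x y].

(* The induced subgraph G - S. *)
Definition delete_vertices (V : finType) (e : rel V) (S : {set V}) :
    rel {x : V | x \notin S} :=
  relpre val e.
Arguments delete_vertices {V} e S.

(* In the last case the unit #|V| of the minimum is never attained: a
   non-complete graph is disconnected by deleting all vertices but two
   non-adjacent ones. The graph on no vertices is connected (not a separated
   graph), so S = V never counts as a separating set. *)
Definition vertex_connectivity (V : finType) (e : rel V) : nat :=
  if ~~ graph_connected e then 0%N
  else if graph_complete e then #|V|.-1
  else \big[minn/#|V|]_(S : {set V} | ~~ graph_connected (delete_vertices e S))
         #|S|.

(* Main.v *)
(** If every vertex has at least three neighbours, then every set missing at
    most two vertices is total dominating, so the three top coefficients of the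
    polynomial are [1], [n] and ['C(n, 2)].  Its [n] roots [z] (with
    multiplicity) satisfy [z ^+ 2 = - 2 z], and their sum is [- n], so Newton's
    identity gives [2 'C(n, 2) = n ^ 2 - 2 n], which forces [n = 0].  Hence some
    vertex has degree at most two, and the connectivity is at most the minimum
    degree. *)

Require Import Defs.
From mathcomp Require Import all_boot all_order all_algebra.
From mathcomp Require Import complex.
From mathcomp Require Import reals.
From mathcomp Require Import zify ring.

Set Implicit Arguments.
Unset Strict Implicit.
Unset Printing Implicit Defensive.

Import Order.TTheory GRing.Theory Num.Theory.
Local Open Scope ring_scope.

Definition neighbours (V : finType) (e : rel V) (v : V) : {set V} :=
  [set u | e v u].

Section Connectivity.

Variables (V : finType) (e : rel V).

Lemma graph_connectedPn :
  reflect (exists x y, ~~ connect e x y) (~~ graph_connected e).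
Proof.
rewrite /graph_connected negb_forall.
apply: (iffP existsP) => [[x]|[x [y nxy]]]; last first.
  by exists x; rewrite negb_forall; apply/existsP; exists y.
by rewrite negb_forall => /existsP[y nxy]; exists x, y.
Qed.

Lemma isolated_disconnected (x y : V) :
  x != y -> (forall z, ~~ e x z) -> ~~ graph_connected e.
Proof.
move=> nxy isox; apply/graph_connectedPn; exists x, y.
apply/connectP => -[[|z p] /=]; first by move=> _ eyx; rewrite eyx eqxx in nxy.
by rewrite (negPf (isox z)).
Qed.

Lemma vertex_connectivity_le_cut (S : {set V}) :
  ~~ graph_complete e -> ~~ graph_connected (delete_vertices e S) ->
  (vertex_connectivity e <= #|S|)%N.
Proof.
move=> ncomp ndisc; rewrite /vertex_connectivity (negPf ncomp).
case: ifP => // _; rewrite -minEnat -leEnat.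
exact: (@bigmin_le_cond _ nat _ _ S).
Qed.

End Connectivity.

Section Degree.

Variables (V : finType) (e : rel V).
Hypothesis e_irr : irreflexive e.

(** Once [S] is deleted, [x] has no neighbour left, while [y] survives as a second vertex. *)
Lemma isolating_set_disconnects (S : {set V}) (x y : V) :
  x != y -> x \notin S -> y \notin S -> neighbours e x \subset S ->
  ~~ graph_connected (delete_vertices e S).
Proof.
move=> nxy xS yS nbS.
apply: (@isolated_disconnected _ _ (Sub x xS) (Sub y yS)) => // -[z zS] /=.
apply/negP => exz; suff : z \in S by rewrite (negPf zS).
by apply: (subsetP nbS); rewrite inE.
Qed.

Lemma vertex_connectivity_le_degree (v : V) :
  (vertex_connectivity e <= #|neighbours e v|)%N.
Proof.
have v_nb : v \notin neighbours e v by rewrite inE e_irr.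
have [comp|ncomp] := boolP (graph_complete e).
  rewrite /vertex_connectivity; case: ifP => // _.
  rewrite comp -(cardsC1 v); apply/subset_leq_card/subsetP => u.
  by rewrite !inE eq_sym => /(implyP (forallP (forallP comp v) u)).
case: (pickP [predC (v |: neighbours e v)]) => [y|dom_v].
  rewrite !inE negb_or eq_sym => /andP[nvy nevy].
  apply: vertex_connectivity_le_cut => //.
  by apply: (isolating_set_disconnects nvy) => //; rewrite inE.
(* Here [v] is adjacent to all other vertices, so its degree is [#|V| - 1];
   delete instead all vertices but two non-adjacent ones. *)
have cardV : #|V| = #|neighbours e v|.+1.
  rewrite -cardsT (_ : [set: V] = v |: neighbours e v) ?cardsU1 ?v_nb //.
  by apply/setP => u; have /negbFE := dom_v u; rewrite !inE.
have := ncomp; rewrite /graph_complete negb_forall => /existsP[x].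
rewrite negb_forall => /existsP[y]; rewrite negb_imply => /andP[nxy nexy].
(* This set has [#|V| - 2] elements, one less than the degree of [v]. *)
apply: (@leq_trans #|~: [set x; y]|).
  apply: vertex_connectivity_le_cut => //.
  apply: (isolating_set_disconnects nxy); rewrite ?inE ?eqxx ?orbT //.
  apply/subsetP => z; rewrite !inE negb_or => exz.
  by apply/andP; split; apply: contraTneq exz => ->; rewrite ?e_irr.
by have := cardsC [set x; y]; rewrite cards2 nxy; lia.
Qed.

(** A set that misses only [i] vertices cannot miss a whole neighbourhood, so every set of
    [#|V| - i] vertices is counted. *)
Lemma total_dom_count_top (i : nat) :
  (forall v, (i < #|neighbours e v|)%N) -> (i <= #|V|)%N ->
  total_dom_count e (#|V| - i) = 'C(#|V|, i).
Proof.
move=> deg le_iV; rewrite -bin_sub // -card_draws; apply: eq_card => D.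
rewrite !inE andb_idl // => /eqP cardD; apply/forallP => v.
have /subsetPn[u] : ~~ (neighbours e v \subset ~: D).
  apply/negP => /subset_leq_card; have := deg v; have := cardsC D; lia.
by rewrite !inE negbK => evu uD; apply/existsP; exists u; rewrite uD.
Qed.

Lemma coef_total_dom_poly_top (i : nat) :
  (forall v, (i < #|neighbours e v|)%N) -> (i <= #|V|)%N ->
  (total_dom_poly e)`_(#|V| - i) = 'C(#|V|, i)%:Z.
Proof.
by move=> deg leiV; rewrite coef_poly total_dom_count_top // ltnS leq_subr.
Qed.

End Degree.

(** Newton's identity for the second elementary symmetric function, doubled to avoid a division.
    Splitting off one root [x] adds [x] times the sum of the others, read off from
    [coefPn_prod_XsubC]. *)
Lemma coefPnn_prod_XsubC (R : comNzRingType) (rs : seq R) (k : nat) :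
  size rs = k.+2 ->
  (\prod_(z <- rs) ('X - z%:P))`_k *+ 2 =
    (\sum_(z <- rs) z) ^+ 2 - \sum_(z <- rs) z ^+ 2.
Proof.
elim: rs k => [//|x rs IH] k [szrs].
rewrite !big_cons mulrBl coefB coefXM coefCM.
have := @coefPn_prod_XsubC R rs; rewrite szrs => /(_ isT) /= ->.
case: k szrs => [|k] szrs /=.
  case: rs szrs {IH} => [|y [|]] // _; rewrite !big_cons !big_nil.
  by ring.
by rewrite mulrnBl (IH _ szrs); ring.
Qed.

Lemma newton_top_coefs (F : closedFieldType) (p : {poly F}) (m : nat) :
  size p = m.+3 -> p \is monic -> {in root p, forall z, z ^+ 2 = - 2 * z} ->
  p`_m *+ 2 = p`_m.+1 ^+ 2 - 2 * p`_m.+1.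
Proof.
move=> szp /monicP lcp rootp.
have [rs prs] := closed_field_poly_normal p; rewrite lcp scale1r in prs.
have szrs : size rs = m.+2 by move: szp; rewrite prs size_prod_XsubC => -[].
have -> : p`_m.+1 = - \sum_(z <- rs) z.
  by rewrite prs -coefPn_prod_XsubC szrs.
rewrite prs coefPnn_prod_XsubC // sqrrN; congr (_ - _).
rewrite mulrN -mulNr mulr_sumr; apply: eq_big_seq => z zrs.
by apply: rootp; rewrite -topredE /= prs root_prod_XsubC.
Qed.

Theorem theorem4p4 (R : realType) (V : finType) (e : rel V) (n : nat)
    (e_sym : symmetric e) (e_irr : irreflexive e) (order_n : #|V| = n)
    (hZ : complex_roots R (total_dom_poly e) =i [:: -2; 0]) :
  (vertex_connectivity e <= 2)%N.
Proof.
have [/existsP[v degv]|] := boolP [exists v, #|neighbours e v| <= 2]%N.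
  exact: leq_trans (vertex_connectivity_le_degree e_irr v) degv.
rewrite negb_exists => /forallP deg; exfalso.
have {}deg v : (2 < #|neighbours e v|)%N by rewrite ltnNge deg.
have top i : (i <= 2)%N -> (i <= #|V|)%N ->
    (total_dom_poly e)`_(#|V| - i) = 'C(#|V|, i)%:Z.
  by move=> lei2; apply: coef_total_dom_poly_top => v; apply: leq_trans (deg v).
pose p : {poly R[i]} := map_poly intr (total_dom_poly e).
have coefp i : p`_i = ((total_dom_poly e)`_i)%:~R by rewrite coef_map.
have rootp z : (z \in root p) = (z \in [:: -2; 0]) by apply: hZ.
have lcp : p`_#|V| = 1 by have := top 0%N isT isT; rewrite coefp subn0 bin0 => ->.
(* On no vertices the polynomial would be the constant 1, which does not vanish at 0. *)
have cardV : (1 < #|V|)%N.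
  case: (pickP (@predT V)) => [v _|V0].
    by apply: leq_trans (ltnW (deg v)) (max_card _).
  have : 0 \in root p by rewrite rootp !inE eqxx orbT.
  by rewrite -topredE /= /root horner_coef0 -(eq_card0 V0) lcp oner_eq0.
have szp : size p = #|V|.+1.
  apply/eqP; rewrite eqn_leq; apply/andP; split.
    exact: leq_trans (size_poly _ _) (size_poly _ _).
  rewrite ltnNge; apply/negP => /leq_sizeP/(_ _ (leqnn _))/eqP.
  by rewrite lcp oner_eq0.
have [m cardVm] : {m | #|V| = m.+2} by exists #|V|.-2; lia.
have /(_ m) := @newton_top_coefs R[i] p.
have monp : p \is monic by rewrite monicE lead_coefE szp lcp.
have c1 : p`_m.+1 = #|V|%:R.
  by rewrite coefp -(_ : (#|V| - 1 = m.+1)%N) ?top ?bin1 //; lia.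
have c2 : p`_m = 'C(#|V|, 2)%:R.
  by rewrite coefp -(_ : (#|V| - 2 = m)%N) ?top //; lia.
rewrite c1 c2 szp cardVm => /(_ erefl monp) newton.
have /newton sum2 : {in root p, forall z, z ^+ 2 = - 2 * z}.
  by move=> z; rewrite rootp !inE => /orP[] /eqP ->; ring.
(* With [n = m.+2] this reads [n * (n - 1) + 2 * n = n ^ 2], that is [n = 0]. It is pulled back from
   [R[i]], where distinct naturals stay distinct. *)
have : (m.+2 * m.+1 + 2 * m.+2 == m.+2 ^ 2)%N.
  have -> : (m.+2 * m.+1 = 'C(m.+2, 2) * 2)%N.
    by rewrite [RHS]mulnC -(mul_bin_diag m.+2 1) bin1.
  by rewrite -(eqr_nat R[i]) natrD !natrM mulr_natr sum2; apply/eqP; ring.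
by move/eqP; lia.
Qed.
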